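(* For $m\leq 4$, every minimal border rank tensor in $\mathbb{C}^m\otimes\mathbb{C}^m\otimes\mathbb{C}^m$ is $1_*$-generic.
   Context: Let $A,B,C$ be copies of $\mathbb{C}^m$. The rank of $T\in A\otimes B\otimes C$ is the smallest $r$ such that $T=\sum_{i=1}^r a_i\otimes b_i\otimes c_i$; its border rank is the smallest $r$ such that $T$ is a limit of tensors of rank at most $r$. A tensor is concise if the three induced linear maps $T_A\colon A^\vee\to B\otimes C$, $T_B\colon B^\vee\to A\otimes C$, $T_C\colon C^\vee\to A\otimes B$ are injective. A tensor has minimal border rank if it is concise and has border rank $m$. A tensor is $1_A$-generic if the image of $T_A$ contains an element of rank $m$ (similarly $1_B$-, $1_C$-generic), and $1_*$-generic if it is at least one of $1_A$-, $1_B$-, $1_C$-generic. *)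

(* Defs.v *)
From mathcomp Require Import all_boot all_order all_algebra.
From mathcomp Require Import all_classical all_reals all_analysis.

Set Implicit Arguments.
Unset Strict Implicit.
Unset Printing Implicit Defensive.

Import Order.TTheory GRing.Theory Num.Theory.
Import numFieldNormedType.Exports.

Local Open Scope classical_set_scope.
Local Open Scope ring_scope.

(* An element of K^m (x) K^m (x) K^m, given by its coordinates in the standard
   basis.  The library puts the metric topology of the norm on a numFieldType
   such as K, but not directly on the type R[i] of complex numbers, so the
   definitions are stated over K, to be instantiated with K := R[i]. *)
Definition tensor (K : numFieldType) (m : nat) : Type :=
  {ffun 'I_m * 'I_m * 'I_m -> K}.

Section Tensors.
Variables (K : numFieldType) (m : nat).
Implicit Types (T : tensor K m) (r : nat) (a b c : 'cV[K]_m).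

Definition pure_tensor a b c : tensor K m :=
  [ffun x : 'I_m * 'I_m * 'I_m => a x.1.1 0 * b x.1.2 0 * c x.2 0].

Definition is_least (P : nat -> Prop) r : Prop :=
  P r /\ forall s : nat, P s -> (r <= s)%N.

Definition decomposable T r : Prop :=
  exists a b c : 'I_r -> 'cV[K]_m,
    T = \sum_(l < r) pure_tensor (a l) (b l) (c l).

Definition has_rank T r : Prop := is_least (decomposable T) r.

Definition rank_at_most T r : Prop :=
  exists2 s : nat, has_rank T s & (s <= r)%N.

(* Convergence in the finite-dimensional space of tensors is convergence of
   every coordinate, for the topology given by the norm of K. *)
Definition tensor_cvg (u : nat -> tensor K m) T : Prop :=
  forall x : 'I_m * 'I_m * 'I_m, u n x @[n --> \oo] --> T x.

Definition limit_of_rank_at_most T r : Prop :=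
  exists2 u : nat -> tensor K m,
    forall n, rank_at_most (u n) r & tensor_cvg u T.

Definition has_border_rank T r : Prop := is_least (limit_of_rank_at_most T) r.

(* Covectors are row vectors in the dual basis, and K^m (x) K^m is identified
   with m x m matrices, the rank of an element being its matrix rank. *)
Definition flatA T (f : 'rV[K]_m) : 'M[K]_m :=
  \matrix_(j, k) \sum_(i < m) f 0 i * T (i, j, k).

Definition flatB T (f : 'rV[K]_m) : 'M[K]_m :=
  \matrix_(i, k) \sum_(j < m) f 0 j * T (i, j, k).

Definition flatC T (f : 'rV[K]_m) : 'M[K]_m :=
  \matrix_(i, j) \sum_(k < m) f 0 k * T (i, j, k).

Definition concise T : Prop :=
  [/\ injective (flatA T), injective (flatB T) & injective (flatC T)].

Definition minimal_border_rank T : Prop := concise T /\ has_border_rank T m.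

Definition oneA_generic T : Prop := exists f, \rank (flatA T f) = m.
Definition oneB_generic T : Prop := exists f, \rank (flatB T f) = m.
Definition oneC_generic T : Prop := exists f, \rank (flatC T f) = m.

Definition one_star_generic T : Prop :=
  [\/ oneA_generic T, oneB_generic T | oneC_generic T].

End Tensors.

(* Main.v *)
(* Over C, a minimal border rank tensor T is the limit of tensors of rank m. The triples (X, Y, Z)
   of matrices acting identically on T through its three factors form a commutative algebra E,
   acting faithfully on each of the three spaces of covectors. For a concise tensor of rank m this
   algebra contains conjugates of all diagonal matrices, so dim E >= m for T by semicontinuity.

   If T is not 1_A-generic, then the E-module A^* is not cyclic: it has a quotient A^*/D of
   dimension 2 on which E acts by a character chi. Suppose this happens for A, B and C. For m <= 4,
   the y in ker chi which annihilate D form a space K of dimension at least 2 and codimension at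
   most 1 in ker chi; it follows that the three characters agree. If some element of ker chi does
   not annihilate ker chi, or if m = 3, then K maps A^* and B^* into lines, which contradicts
   conciseness. Otherwise m = 4, (ker chi)^2 = 0 and dim ker chi >= 3; then conciseness forces
   every orbit (ker chi) a to be at most a line, so that dim ker chi <= 2. *)
Require Import Defs.
From HB Require Import structures.
From mathcomp Require Import all_boot all_order all_algebra.
From mathcomp Require Import all_classical all_reals all_analysis.
From mathcomp Require Import complex.
From mathcomp Require Import zify.

Set Implicit Arguments.
Unset Strict Implicit.
Unset Printing Implicit Defensive.

Import Order.TTheory GRing.Theory Num.Theory.
Import numFieldNormedType.Exports.
Local Open Scope classical_set_scope.
Local Open Scope ring_scope.

(** * Dimension counts for subspaces and linear maps *)

Section Subspaces.
Variable F : fieldType.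
Implicit Types U V : vectType F.

Lemma dimv_addv_line V (W : {vspace V}) v :
  v \notin W -> \dim (W + <[v]>)%VS = (\dim W).+1.
Proof.
move=> vW; have v0 : v != 0 by apply: contraNneq vW => ->; rewrite mem0v.
rewrite dimv_disjoint_sum ?dim_vline ?v0 ?addn1 //.
apply/eqP; rewrite -subv0; apply/subvP => u /memv_capP[uW /vlineP[k uE]].
by rewrite memv0 uE scaler_eq0; move: uW; rewrite uE rpredZeq (negPf vW) orbF => ->.
Qed.

Lemma subv_proper V (W W' : {vspace V}) :
  (\dim W < \dim W')%N -> exists2 v, v \in W' & v \notin W.
Proof.
by move=> dW; apply/subvPn/negP => /dimvS; lia.
Qed.

Lemma closed_pred_vspace V (P : V -> Prop) :
  P 0 -> (forall a u v, P u -> P v -> P (a *: u + v)) ->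
  exists W : {vspace V}, forall v, v \in W <-> P v.
Proof.
move=> P0 Plin.
pose Q n := `[<exists W : {vspace V}, \dim W = n /\ forall v, v \in W -> P v>].
have exQ : exists n, Q n.
  exists 0%N; apply/asboolP; exists 0%VS; split=> [|v]; first by rewrite dimv0.
  by rewrite memv0 => /eqP->.
have ubQ n : Q n -> (n <= dim V)%N.
  by move=> /asboolP[W [<- _]]; rewrite -dimvf dimvS ?subvf.
case: (ex_maxnP exQ ubQ) => n /asboolP[W [dW WP]] nmax; exists W => v; split; first exact: WP.
move=> Pv; apply: contraT => vW.
suff /nmax : Q n.+1 by rewrite ltnn.
apply/asboolP; exists (W + <[v]>)%VS; split; first by rewrite dimv_addv_line ?dW.
move=> _ /memv_addP[w wW [_ /vlineP[k ->] ->]].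
by rewrite addrC; apply: Plin => //; apply: WP.
Qed.

Lemma linear_preim U V (f : U -> V) (S : {vspace U}) (D D' : {vspace V}) :
    linear f -> (forall y, y \in S -> f y \in D) -> (D' <= D)%VS ->
  exists K : {vspace U}, (forall y, (y \in K) = (y \in S) && (f y \in D')) /\
    (\dim S + \dim D' <= \dim K + \dim D)%N.
Proof.
move=> lf fSD D'D.
pose fL : {linear U -> V} := HB.pack f (GRing.isLinear.Build F U V *:%R f lf).
pose g := linfun fL; have gE y : g y = f y by rewrite lfunE.
exists (S :&: g @^-1: D')%VS; split=> [y|].
  by rewrite memv_cap -memv_preim gE.
set K := (_ :&: _)%VS.
have dS := limg_ker_dim g S; have dK := limg_ker_dim g K.
have kerE : (K :&: lker g = S :&: lker g)%VS.
  apply/vspaceP => y; rewrite !memv_cap -memv_preim memv_ker -andbA; congr (_ && _).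
  by case: eqP => [->|]; rewrite ?andbF ?mem0v.
have := dimvS (_ : (g @: S :&: D' <= g @: K)%VS).
move=> /(_ _)/wrap[].
  apply/subvP => _ /memv_capP[/memv_imgP[y yS ->]] fD'.
  by apply/memv_imgP; exists y => //; rewrite memv_cap yS -memv_preim.
have dc := dimv_sum_cap (g @: S) D'.
have := dimvS (_ : (g @: S + D' <= D)%VS).
move=> /(_ _)/wrap[].
  rewrite subv_add D'D andbT; apply/subvP => _ /memv_imgP[y yS ->].
  by rewrite gE fSD.
rewrite kerE in dK; lia.
Qed.

Lemma linear_kernel U V (f : U -> V) (S : {vspace U}) (D : {vspace V}) :
    linear f -> (forall y, y \in S -> f y \in D) ->
  exists K : {vspace U}, (forall y, (y \in K) = (y \in S) && (f y == 0)) /\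
    (\dim S <= \dim K + \dim D)%N.
Proof.
move=> lf fSD; have [|K [KE dK]] := linear_preim lf fSD (D' := 0%VS); first exact: sub0v.
by exists K; split=> [y|]; rewrite ?KE ?memv0 //; rewrite dimv0 addn0 in dK.
Qed.

Lemma vspace_neq0 V (W : {vspace V}) : (0 < \dim W)%N -> exists2 v, v \in W & v != 0.
Proof.
by rewrite lt0n dimv_eq0 -vpick0 => Wn0; exists (vpick W); rewrite ?memv_pick.
Qed.

Lemma linear_kernel_neq0 U V (f : U -> V) (S : {vspace U}) (D : {vspace V}) :
    linear f -> (forall y, y \in S -> f y \in D) -> (\dim D < \dim S)%N ->
  exists y, [/\ y \in S, y != 0 & f y = 0].
Proof.
move=> lf fSD dlt; have [K [KE dK]] := linear_kernel lf fSD.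
have [|y yK y0] := @vspace_neq0 _ K; first by lia.
by move: yK; rewrite KE => /andP[yS /eqP fy]; exists y.
Qed.

Lemma linear_functional_kernel U (f : U -> F^o) (S : {vspace U}) :
    linear f ->
  exists K : {vspace U}, (forall y, (y \in K) = (y \in S) && (f y == 0)) /\
    (\dim S <= (\dim K).+1)%N.
Proof.
move=> lf; have [|K [KE dK]] := linear_kernel lf (S := S) (D := fullv).
  by move=> y _; rewrite memvf.
by exists K; split=> //; move: dK; rewrite dimvf addn1.
Qed.

Lemma line_or_span V (P : V -> Prop) (D : {vspace V}) :
    (\dim D <= 2)%N -> (forall v, P v -> v \in D) ->
  (exists g, forall v, P v -> v \in <[g]>%VS) \/
  (\dim D = 2%N /\ forall W : {vspace V}, (forall v, P v -> v \in W) -> (D <= W)%VS).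
Proof.
move=> dD PD; have [[u Pu u0]|all0] := pselect (exists2 u, P u & u != 0); last first.
  left; exists 0 => v Pv; case: (eqVneq v 0) => [->|v0]; first by rewrite mem0v.
  by case: all0; exists v.
have [[v Pv vu]|alll] := pselect (exists2 v, P v & v \notin <[u]>%VS); last first.
  by left; exists u => v Pv; apply: contraT => vu; case: alll; exists v.
have duv := dimv_addv_line vu; rewrite dim_vline u0 in duv.
have sD : (<[u]> + <[v]> <= D)%VS.
  by rewrite subv_add -!memvE !PD.
have := dimvS sD; rewrite duv => d2; right; split; first lia.
move=> W PW; suff <- : (<[u]> + <[v]>)%VS = D by rewrite subv_add -!memvE !PW.
by apply/eqP; rewrite eqEdim sD duv.
Qed.

Lemma eigen_scalar V (f : V -> V) (D : {vspace V}) :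
    linear f -> (forall d, d \in D -> f d \in <[d]>%VS) ->
  exists a, forall d, d \in D -> f d = a *: d.
Proof.
move=> lf fD.
have f0 : f 0 = 0 by have /vlineP[k ->] := fD 0 (mem0v _); rewrite scaler0.
have [D0|[d dD d0]] : (D = 0%VS) \/ exists2 d, d \in D & d != 0.
  have [|] := posnP (\dim D); first by move=> /eqP; rewrite dimv_eq0 => /eqP; left.
  by move=> /vspace_neq0; right.
  by exists 0 => d; rewrite D0 memv0 => /eqP->; rewrite f0 scaler0.
have /vlineP[a fd] := fD d dD; exists a => e eD.
have fZ k v : f (k *: v) = k *: f v by have := lf k v 0; rewrite f0 !addr0.
have [/vlineP[k ->]|ned] := boolP (e \in <[d]>%VS).
  by rewrite fZ fd !scalerA mulrC.
have /vlineP[b fe] := fD e eD.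
have /vlineP[c] := fD _ (memvD dD eD).
have := lf 1 d e; rewrite !scale1r => ->; rewrite fd fe scalerDr => /eqP.
rewrite -subr_eq0 opprD addrACA -!scalerBl addrC => /eqP bc.
have bc0 : b = c.
  apply/eqP; rewrite -subr_eq0; apply: contraNT ned => nz.
  have := congr1 (fun x => (b - c)^-1 *: x) bc.
  rewrite scalerDr !scalerA mulVf // scale1r scaler0 => /eqP.
  by rewrite addr_eq0 => /eqP ->; rewrite memvN !memvZ ?memv_line.
rewrite bc0; move: bc; rewrite bc0 subrr scale0r add0r => /eqP.
by rewrite scaler_eq0 (negPf d0) orbF subr_eq0 => /eqP->.
Qed.

End Subspaces.

(** * Balanced trilinear forms *)

(* The three factors are covector spaces, on which [E] acts on the right by matrices; for a
   tensor, [E] consists of the triples (X, Y, Z) of the 111-algebra of the paper. *)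
Record balanced_form (F : fieldType) (m : nat) (E : vectType F) := BalancedForm {
  actA : E -> 'M[F]_m;
  actB : E -> 'M[F]_m;
  actC : E -> 'M[F]_m;
  form : 'rV[F]_m -> 'rV[F]_m -> 'rV[F]_m -> F^o;
  actA_linear : linear actA;
  actB_linear : linear actB;
  actC_linear : linear actC;
  formA_linear : forall b c, linear (fun a => form a b c);
  formB_linear : forall a c, linear (fun b => form a b c);
  formC_linear : forall a b, linear (fun c => form a b c);
  formAB : forall y a b c, form (a *m actA y) b c = form a (b *m actB y) c;
  formBC : forall y a b c, form a (b *m actB y) c = form a b (c *m actC y);
  formA_nondeg : forall a, (forall b c, form a b c = 0) -> a = 0;
  formB_nondeg : forall b, (forall a c, form a b c = 0) -> b = 0;
  formC_nondeg : forall c, (forall a b, form a b c = 0) -> c = 0;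
  form_faithful : forall y, (forall a b c, form (a *m actA y) b c = 0) -> y = 0 }.

Arguments actA {F m E}.
Arguments actB {F m E}.
Arguments actC {F m E}.
Arguments form {F m E}.
Arguments formA_nondeg {F m E} T a : rename.
Arguments formB_nondeg {F m E} T b : rename.
Arguments formC_nondeg {F m E} T c : rename.
Arguments form_faithful {F m E} T y : rename.

Definition swap_balanced (F : fieldType) m (E : vectType F) (T : balanced_form m E) :
  balanced_form m E.
Proof.
refine (@BalancedForm F m E (actB T) (actA T) (actC T) (fun b a c => form T a b c)
  (actB_linear T) (actA_linear T) (actC_linear T)
  (fun b c => formB_linear T b c) (fun b c => formA_linear T b c)
  (fun a b => formC_linear T b a) _ _ (formB_nondeg T) (formA_nondeg T) _ _).
- by move=> y b a c; rewrite formAB.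
- by move=> y b a c; rewrite formAB formBC.
- by move=> c c0; apply: (formC_nondeg T) => a b; apply: c0.
- by move=> y y0; apply: (form_faithful T) => a b c; rewrite formAB.
Defined.

Definition rot_balanced (F : fieldType) m (E : vectType F) (T : balanced_form m E) :
  balanced_form m E.
Proof.
refine (@BalancedForm F m E (actB T) (actC T) (actA T) (fun b c a => form T a b c)
  (actB_linear T) (actC_linear T) (actA_linear T)
  (fun c a => formB_linear T a c) (fun b a => formC_linear T a b)
  (fun b c => formA_linear T b c) _ _ _ _ (formA_nondeg T) _).
- by move=> y b c a; rewrite formBC.
- by move=> y b c a; rewrite formAB formBC.
- by move=> b b0; apply: (formB_nondeg T) => a c; apply: b0.
- by move=> c c0; apply: (formC_nondeg T) => a b; apply: c0.
- by move=> y y0; apply: (form_faithful T) => a b c; rewrite formAB.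
Defined.

Section Balanced.
Variables (F : fieldType) (m : nat) (E : vectType F).
Implicit Types (T : balanced_form m E) (K : {vspace E}) (D W : {vspace 'rV[F]_m}).

Lemma form0l T b c : form T 0 b c = 0.
Proof.
by have /= := formA_linear T b c (-1) 0 0; rewrite scaler0 addr0 scaleN1r addNr.
Qed.

Lemma form0m T a c : form T a 0 c = 0.
Proof. exact: (form0l (swap_balanced T)). Qed.

Lemma formZl T k a b c : form T (k *: a) b c = k * form T a b c.
Proof. by have /= := formA_linear T b c k a 0; rewrite form0l !addr0. Qed.

Lemma formZm T k a b c : form T a (k *: b) c = k * form T a b c.
Proof. exact: (formZl (swap_balanced T)). Qed.

Lemma formBl T a a' b c : form T (a - a') b c = form T a b c - form T a' b c.
Proof.
have /= lin := formA_linear T b c (-1) a' a; rewrite !scaleN1r in lin.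
by rewrite addrC lin addrC.
Qed.

Lemma formA_inj T a a' : (forall b c, form T a b c = form T a' b c) -> a = a'.
Proof.
move=> aa'; apply/eqP; rewrite -subr_eq0; apply/eqP; apply: (formA_nondeg T) => b c.
by rewrite formBl aa' subrr.
Qed.

Lemma actA_mulC T y z (a : 'rV_m) : a *m actA T y *m actA T z = a *m actA T z *m actA T y.
Proof.
apply: (formA_inj (T := T)) => b c.
by rewrite [LHS]formAB [LHS]formBC [LHS]formAB [RHS]formAB [RHS]formAB [RHS]formBC.
Qed.

Lemma actA_faithful T y : (forall a : 'rV_m, a *m actA T y = 0) -> y = 0.
Proof. by move=> y0; apply: (form_faithful T) => a b c; rewrite y0 form0l. Qed.

Lemma actA_neq0 T y : y != 0 -> exists a : 'rV_m, a *m actA T y != 0.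
Proof.
move=> y0; apply: contrapT => no; move/eqP: y0; apply; apply: (actA_faithful (T := T)) => a.
by apply/eqP/negPn/negP => ay; apply: no; exists a.
Qed.

Lemma mulmx_actA_linear T (a : 'rV_m) : linear (fun y => a *m actA T y).
Proof. by move=> k y z; rewrite actA_linear mulmxDr -scalemxAr. Qed.

Lemma mulmxl_linear (X : 'M[F]_m) : linear (fun a : 'rV_m => a *m X).
Proof. by move=> k a b; rewrite mulmxDl -scalemxAl. Qed.

Lemma actA0 T : actA T 0 = 0.
Proof. by have := actA_linear T (-1) 0 0; rewrite scaler0 addr0 scaleN1r addNr. Qed.

Lemma mulmx_actAZ T (a : 'rV_m) k y : a *m actA T (k *: y) = k *: (a *m actA T y).
Proof. by have := mulmx_actA_linear T a k y 0; rewrite !actA0 mulmx0 !addr0. Qed.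

Lemma mulmx_actAB T (a : 'rV_m) y z :
  a *m actA T (y - z) = a *m actA T y - a *m actA T z.
Proof.
have /= lin := mulmx_actA_linear T a (-1) z y; rewrite !scaleN1r in lin.
by rewrite addrC lin addrC.
Qed.

(* Each [b] is annihilated by some nonzero [y] in [K], and [y] maps some covector to a nonzero
   multiple of [g]; hence [form T g b = 0]. *)
Lemma balanced_line_absurd T K g D :
    (forall y, y \in K -> forall a : 'rV_m, a *m actA T y \in <[g]>%VS) ->
    (forall y, y \in K -> forall b : 'rV_m, b *m actB T y \in D) ->
  (\dim D < \dim K)%N -> False.
Proof.
move=> Kg KD dDK.
have g0 : g = 0.
  apply: (formA_nondeg T) => b c.
  have [|y [yK y0 by0]] := linear_kernel_neq0 (mulmx_actA_linear (swap_balanced T) b) _ dDK.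
    by move=> y yK; apply: KD.
  have [a ay] := actA_neq0 T y0; have /vlineP[k ayE] := Kg y yK a.
  have := formAB T y a b c; rewrite [b *m _]by0 ayE formZl.
  rewrite form0m => /eqP; rewrite mulf_eq0 => /orP[/eqP k0|/eqP//].
  by move: ay; rewrite ayE k0 scale0r eqxx.
have [|y yK y0] := @vspace_neq0 _ _ K; first by lia.
have [a] := actA_neq0 T y0; have /vlineP[k ->] := Kg y yK a.
by rewrite g0 scaler0 eqxx.
Qed.

Lemma balanced_span T K (DA DB : {vspace 'rV[F]_m}) :
    (2 < \dim K)%N -> (\dim DA <= 2)%N -> (\dim DB <= 2)%N ->
    (forall y, y \in K -> forall a : 'rV_m, a *m actA T y \in DA) ->
    (forall y, y \in K -> forall b : 'rV_m, b *m actB T y \in DB) ->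
  \dim DA = 2%N /\
  forall W, (forall y, y \in K -> forall a : 'rV_m, a *m actA T y \in W) -> (DA <= W)%VS.
Proof.
move=> dK dA dB KA KB.
pose P v := exists2 y, y \in K & exists a : 'rV_m, v = a *m actA T y.
have [|[g Pg]|[dA2 DAmin]] := @line_or_span _ _ P DA dA.
- by move=> _ [y yK [a ->]]; apply: KA.
- case: (@balanced_line_absurd T K g DB) => //; last by lia.
  by move=> y yK a; apply: Pg; exists y => //; exists a.
split=> // W KW; apply: DAmin => _ [y yK [a ->]]; exact: KW.
Qed.

Lemma kernel_vspace (X : 'M[F]_m) :
  exists W, forall v : 'rV_m, v \in W <-> v *m X = 0.
Proof.
apply: (@closed_pred_vspace _ _ (fun v : 'rV_m => v *m X = 0)); first by rewrite mul0mx.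
by move=> k u v u0 v0; rewrite mulmxDl -scalemxAl u0 v0 scaler0 addr0.
Qed.

Lemma square_zero_kills T K (DA DB : {vspace 'rV[F]_m}) :
    (2 < \dim K)%N -> (\dim DA <= 2)%N -> (\dim DB <= 2)%N ->
    (forall y, y \in K -> forall a : 'rV_m, a *m actA T y \in DA) ->
    (forall y, y \in K -> forall b : 'rV_m, b *m actB T y \in DB) ->
    (forall y z, y \in K -> z \in K -> forall a : 'rV_m, a *m actA T y *m actA T z = 0) ->
  forall y a, y \in K -> a \in DA -> a *m actA T y = 0.
Proof.
move=> dK dA dB KA KB KK z a zK aD.
have [_ DAmin] := balanced_span dK dA dB KA KB.
have [W WE] := kernel_vspace (actA T z); apply/WE.
apply: (subvP (DAmin W _)) => // y yK a'; apply/WE; exact: KK.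
Qed.

Lemma dim_fullv_rV : \dim {: 'rV[F]_m} = m.
Proof. by rewrite dimvf dim_matrix mul1r. Qed.

Lemma mem_full D : \dim D = m -> forall v, v \in D.
Proof.
move=> dD v; suff -> : D = fullv by rewrite memvf.
by apply/eqP; rewrite eqEdim subvf dim_fullv_rV dD leqnn.
Qed.

End Balanced.

Section SquareZero.
Variables (F : fieldType) (E : vectType F).
Implicit Types (T : balanced_form 4 E) (K : {vspace E}) (D : {vspace 'rV[F]_4}).

Lemma square_zero_socle T K DA DB (a0 : 'rV_4) :
    (2 < \dim K)%N -> (\dim DA <= 2)%N -> (\dim DB <= 2)%N ->
    (forall y, y \in K -> forall a : 'rV_4, a *m actA T y \in DA) ->
    (forall y, y \in K -> forall b : 'rV_4, b *m actB T y \in DB) ->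
    (forall y z, y \in K -> z \in K -> forall a : 'rV_4, a *m actA T y *m actA T z = 0) ->
    (forall y, y \in K -> a0 *m actA T y = 0) ->
  a0 \in DA.
Proof.
move=> dK dA dB KA KB KK Ka0; apply: contraT => a0D.
have KD := square_zero_kills dK dA dB KA KB KK.
have [dA2 _] := balanced_span dK dA dB KA KB.
have d3 := dimv_addv_line a0D; rewrite dA2 in d3.
have [|a1 _ a1D] := @subv_proper _ _ (DA + <[a0]>)%VS (@fullv _ 'rV[F]_4).
  by rewrite d3 dim_fullv_rV.
have d4 := dimv_addv_line a1D; rewrite d3 in d4.
have [| |y [yK y0 a1y]] := @linear_kernel_neq0 _ _ _ _ K DA (mulmx_actA_linear T a1).
- by move=> y yK; apply: KA.
- by rewrite dA2.
move/eqP: y0; case; apply: (actA_faithful (T := T)) => a.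
have := mem_full d4 a => /memv_addP[u /memv_addP[d dD [_ /vlineP[k ->] ->]] [_ /vlineP[l ->] ->]].
by rewrite !mulmxDl -!scalemxAl a1y Ka0 // KD // !scaler0 !addr0.
Qed.

Lemma square_zero_absurd T K DA DB DC :
    (2 < \dim K)%N -> (\dim DA <= 2)%N -> (\dim DB <= 2)%N -> (\dim DC <= 2)%N ->
    (forall y, y \in K -> forall a : 'rV_4, a *m actA T y \in DA) ->
    (forall y, y \in K -> forall b : 'rV_4, b *m actB T y \in DB) ->
    (forall y, y \in K -> forall c : 'rV_4, c *m actC T y \in DC) ->
    (forall y z, y \in K -> z \in K -> forall a : 'rV_4, a *m actA T y *m actA T z = 0) ->
  False.
Proof.
move=> dK dA dB dC KA KB KC KK.
have KKC y z : y \in K -> z \in K -> forall c : 'rV_4, c *m actC T y *m actC T z = 0.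
  move=> yK zK c; apply: (formC_nondeg T) => a b.
  by rewrite -[form _ _ _ _]formBC -formAB -formBC -formAB KK // form0l.
have socC := @square_zero_socle (rot_balanced (rot_balanced T)) K DC DA _ dK dC dA KC KA KKC.
have KD := square_zero_kills dK dA dB KA KB KK.
have [dA2 _] := balanced_span dK dA dB KA KB.
have [dB2 _] := @balanced_span _ _ _ (swap_balanced T) K DB DA dK dB dA KB KA.
have line_orbit (a : 'rV_4) : exists g, forall y, y \in K -> a *m actA T y \in <[g]>%VS.
  pose P v := exists2 y, y \in K & v = a *m actA T y.
  have [|[g Pg]|[_ DAmin]] := @line_or_span _ _ P DA dA.
  - by move=> _ [y yK ->]; apply: KA.
  - by exists g => y yK; apply: Pg; exists y.
  have [| |y0 [y0K y0n0 ay0]] := @linear_kernel_neq0 _ _ _ _ K DA (mulmx_actA_linear T a).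
  - by move=> y yK; apply: KA.
  - by rewrite dA2.
  have [b0 f1n0] := actA_neq0 (swap_balanced T) y0n0.
  set f1 := b0 *m _ in f1n0.
  have f1D : f1 \in DB by apply: KB.
  have af1 c : form T a f1 c = 0 by rewrite -formAB ay0 form0l.
  have [|f2 f2D f2f1] := @subv_proper _ _ <[f1]>%VS DB; first by rewrite dim_vline f1n0 dB2.
  have dB' := dimv_addv_line f2f1; rewrite dim_vline f1n0 in dB'.
  have DBE : DB = (<[f1]> + <[f2]>)%VS.
    by apply/eqP; rewrite eq_sym eqEdim subv_add -!memvE f1D f2D dB' dB2.
  have [H [HE dH]] := linear_functional_kernel fullv (formC_linear T a f2).
  rewrite dim_fullv_rV in dH.
  have [|c0 c0H c0D] := @subv_proper _ _ DC H; first by lia.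
  move: c0H; rewrite HE memvf /= => /eqP af2.
  have aDB f : f \in DB -> form T a f c0 = 0.
    rewrite DBE => /memv_addP[_ /vlineP[k ->] [_ /vlineP[l ->] ->]].
    by rewrite (formB_linear T a c0 k) af1 formZm af2 mulr0 scaler0 addr0.
  case/negP: c0D; apply: socC => y yK; apply: (formC_nondeg T) => a' b.
  rewrite -[form _ _ _ _]formBC -formAB.
  have [||W WE] := @closed_pred_vspace _ _ (fun v : 'rV_4 => form T v b c0 = 0).
  - exact: form0l.
  - by move=> k u v u0 v0; rewrite (formA_linear T b c0 k) u0 v0 scaler0 addr0.
  apply/WE; apply: (subvP (DAmin W _)); last by apply: KA.
  move=> _ [z zK ->]; apply/WE; rewrite formAB; apply: aDB; exact: KB.
have [|a1 _ a1D] := @subv_proper _ _ DA (@fullv _ 'rV[F]_4).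
  by rewrite dA2 dim_fullv_rV.
have d3 := dimv_addv_line a1D; rewrite dA2 in d3.
have [|a2 _ a2D] := @subv_proper _ _ (DA + <[a1]>)%VS (@fullv _ 'rV[F]_4).
  by rewrite d3 dim_fullv_rV.
have d4 := dimv_addv_line a2D; rewrite d3 in d4.
have [g1 Kg1] := line_orbit a1; have [g2 Kg2] := line_orbit a2.
have [K1 [K1E dK1]] := linear_kernel (mulmx_actA_linear T a1) Kg1.
have dg1 : (\dim <[g1]> <= 1)%N by rewrite dim_vline leq_b1.
have dg2 : (\dim <[g2]> <= 1)%N by rewrite dim_vline leq_b1.
have [| |y [yK1 y0 a2y]] := @linear_kernel_neq0 _ _ _ _ K1 <[g2]>%VS (mulmx_actA_linear T a2).
- by move=> y; rewrite K1E => /andP[yK _]; apply: Kg2.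
- by lia.
move: yK1; rewrite K1E => /andP[yK /eqP a1y].
move/eqP: y0; case; apply: (actA_faithful (T := T)) => a.
have := mem_full d4 a => /memv_addP[u /memv_addP[d dD [_ /vlineP[k ->] ->]] [_ /vlineP[l ->] ->]].
by rewrite !mulmxDl -!scalemxAl a1y a2y KD // !scaler0 !addr0.
Qed.

End SquareZero.

(** * Characters of non-cyclic modules *)

Section Characters.
Variables (F : fieldType) (m : nat) (E : vectType F).
Implicit Types (T : balanced_form m E) (chi : E -> F^o) (K : {vspace E}).
Implicit Types D : {vspace 'rV[F]_m}.

(* [E] acts through [chi] on the quotient of the first factor by [D], of dimension at least 2. *)
Definition double_quotient_char T chi D :=
  [/\ linear chi, (\dim D + 2 <= m)%N &
      forall y (a : 'rV_m), a *m actA T y - chi y *: a \in D].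

Lemma double_quotient_char_mem T chi D y (a : 'rV_m) :
  double_quotient_char T chi D -> chi y = 0 -> a *m actA T y \in D.
Proof. by case=> _ _ /(_ y a) + y0; rewrite y0 scale0r subr0. Qed.

Lemma scalar_on_sub T chi D (M : {vspace E}) :
    (m <= 4)%N -> double_quotient_char T chi D ->
    (forall y, y \in M -> chi y = 0) -> (m <= (\dim M).+1)%N -> (0 < \dim M)%N ->
  exists S, [/\ (S <= M)%VS, (2 <= \dim S)%N, (\dim M <= (\dim S).+1)%N &
    forall y, y \in S -> exists k, forall d, d \in D -> d *m actA T y = k *: d].
Proof.
move=> m4 chiD M0 dM Mn0; have [lchi dD chiS] := chiD.
have MD y (a : 'rV_m) : y \in M -> a *m actA T y \in D.
  by move=> yM; apply: (double_quotient_char_mem _ chiD); apply: M0.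
have Dn0 : (0 < \dim D)%N.
  have [y yM y0] := vspace_neq0 Mn0; have [a ay] := actA_neq0 T y0.
  rewrite lt0n dimv_eq0; apply: contraNneq ay => D0.
  by rewrite -memv0 -D0 MD.
have [[d dD' [y0 y0M ndy]]|allS] :=
  pselect (exists2 d, d \in D & exists2 y0, y0 \in M & d *m actA T y0 \notin <[d]>%VS); last first.
  exists M; split; [exact: subvv | lia | lia |].
  move=> y yM; apply: (@eigen_scalar _ _ (fun d => d *m actA T y)); first exact: mulmxl_linear.
  by move=> d dD'; apply: contraT => nd; case: allS; exists d => //; exists y.
have d0 : d != 0 by apply: contraNneq ndy => ->; rewrite mul0mx mem0v.
have dspan := dimv_addv_line ndy; rewrite dim_vline d0 in dspan.
have spanD : (<[d]> + <[d *m actA T y0]> <= D)%VS by rewrite subv_add -!memvE dD' MD.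
have dD2 : \dim D = 2%N by have := dimvS spanD; rewrite dspan; lia.
have DE : D = (<[d]> + <[d *m actA T y0]>)%VS.
  by apply/eqP; rewrite eq_sym eqEdim spanD dspan dD2.
have [||S [SE dS]] := @linear_preim _ _ _ _ M D <[d]>%VS (mulmx_actA_linear T d).
- by move=> y yM; apply: MD.
- by rewrite -memvE.
rewrite dim_vline d0 in dS.
exists S; split; [by apply/subvP => y; rewrite SE => /andP[] | lia | lia |].
move=> y; rewrite SE => /andP[yM /vlineP[k dy]]; exists k => e.
rewrite DE => /memv_addP[_ /vlineP[p ->] [_ /vlineP[q ->] ->]].
by rewrite mulmxDl -!scalemxAl actA_mulC dy -scalemxAl scalerDr !scalerA !(mulrC k).
Qed.

Lemma kills_double_quotient T chi D (M : {vspace E}) :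
    (m <= 4)%N -> (m <= dim E)%N -> double_quotient_char T chi D ->
    (forall y, (y \in M) = (chi y == 0)) ->
  exists K, [/\ (K <= M)%VS, (2 <= \dim K)%N, (\dim M <= (\dim K).+1)%N &
    forall y, y \in K -> forall d, d \in D -> d *m actA T y = 0].
Proof.
move=> m4 mE chiD ME; have [lchi dD chiS] := chiD.
have [M' [M'E dM']] := linear_functional_kernel fullv lchi.
have MM' : M = M' by apply/vspaceP => y; rewrite M'E memvf ME.
rewrite dimvf -MM' in dM'.
have [|||S [SM dS dMS Sscal]] := scalar_on_sub (M := M) m4 chiD.
- by move=> y; rewrite ME => /eqP.
- by lia.
- by lia.
exists S; split=> // y yS d dD'; apply/eqP/negPn/negP => dyn0.
(* Rescaled, [y] is the identity on [D], so that every [z] in [S] is a multiple of [y]. *)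
have [k ky] := Sscal y yS.
have k0 : k != 0 by apply: contraNneq dyn0 => k0; rewrite ky // k0 scale0r.
suff : (S <= <[y]>)%VS by move/dimvS; rewrite dim_vline; lia.
apply/subvP => z zS; have [l lz] := Sscal z zS; apply/vlineP; exists (l / k).
apply/eqP; rewrite -subr_eq0; apply/eqP; apply: (actA_faithful (T := T)) => a.
have Da w : w \in S -> a *m actA T w \in D.
  by move=> /(subvP SM); rewrite ME => /eqP; apply: double_quotient_char_mem.
have yz : k *: (a *m actA T z) = l *: (a *m actA T y).
  by rewrite -ky ?Da // actA_mulC lz ?Da.
by rewrite mulmx_actAB mulmx_actAZ mulrC -scalerA -yz scalerA mulVf ?scale1r ?subrr.
Qed.

Lemma kills_char T chi D y z (a : 'rV_m) :
    double_quotient_char T chi D -> (forall d, d \in D -> d *m actA T y = 0) ->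
  a *m actA T z *m actA T y = chi z *: (a *m actA T y).
Proof.
case=> _ _ chiS Dy; apply/eqP; rewrite -subr_eq0 scalemxAl -mulmxBl.
by rewrite Dy ?chiS.
Qed.

End Characters.

Section CommonCharacter.
Variables (F : fieldType) (m : nat) (E : vectType F) (T : balanced_form m E).
Variables (chi chi' : E -> F^o) (D D' : {vspace 'rV[F]_m}).
Hypotheses (m4 : (m <= 4)%N) (mE : (m <= dim E)%N).
Hypothesis chiD : double_quotient_char T chi D.
Hypothesis chiD' : double_quotient_char (swap_balanced T) chi' D'.

Lemma double_quotient_char_eq z : chi z = chi' z.
Proof.
have [lchi _ _] := chiD; have [lchi' _ _] := chiD'.
have [M [ME' _]] := linear_functional_kernel fullv lchi.
have [M' [ME'' _]] := linear_functional_kernel fullv lchi'.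
have ME y : (y \in M) = (chi y == 0) by rewrite ME' memvf.
have M'E y : (y \in M') = (chi' y == 0) by rewrite ME'' memvf.
have [K [KM dK dMK KD]] := kills_double_quotient m4 mE chiD ME.
have [K' [KM' dK' dMK' KD']] := kills_double_quotient m4 mE chiD' M'E.
have Kact y x a b c : y \in K ->
    form T (a *m actA T x *m actA T y) b c = chi x * form T (a *m actA T y) b c.
  by move=> yK; rewrite (kills_char _ _ chiD (KD y yK)) formZl.
have K'act y x a b c : y \in K' ->
    form T (a *m actA T x *m actA T y) b c = chi' x * form T (a *m actA T y) b c.
  move=> yK; rewrite [LHS]formAB [LHS]formAB (@actA_mulC _ _ _ (swap_balanced T)).
  by rewrite (kills_char _ _ chiD' (KD' y yK)) formZm formAB.
have [cap0|/vspace_neq0[y /memv_capP[yK yK'] y0]] := posnP (\dim (K :&: K')%VS); last first.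
  have [a] := actA_neq0 T y0; apply: contra_neq_eq => chin; apply: (formA_nondeg T) => b c.
  have := K'act y z a b c yK'; rewrite Kact // => /eqP.
  by rewrite -subr_eq0 -mulrBl mulf_eq0 subr_eq0 (negPf chin) => /eqP.
have [y' y'K' y'0] : exists2 y, y \in K' & y != 0 by apply: vspace_neq0; lia.
have KM'_sub : (K <= M')%VS.
  apply/subvP => y yK; rewrite M'E; apply: contraT => chiy.
  have yy' : chi' y *: y' = chi y' *: y.
    apply/eqP; rewrite -subr_eq0; apply/eqP; apply: (form_faithful T) => a b c.
    rewrite mulmx_actAB !mulmx_actAZ formBl !formZl -K'act //.
    by rewrite actA_mulC Kact // subrr.
  have : y' \in (K :&: K')%VS.
    rewrite memv_cap y'K' andbT -[y']scale1r -(mulVf chiy) -scalerA yy'.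
    by rewrite !memvZ.
  move: cap0 => /eqP; rewrite dimv_eq0 => /eqP ->; rewrite memv0.
  by rewrite (negPf y'0).
have sKK' : (K + K' <= M')%VS by rewrite subv_add KM'_sub KM'.
have := dimvS sKK'; have := dimv_sum_cap K K'; lia.
Qed.
End CommonCharacter.

Lemma double_quotient_chars_absurd (F : fieldType) (m : nat) (E : vectType F)
    (T : balanced_form m E) (chiA chiB chiC : E -> F^o) (DA DB DC : {vspace 'rV[F]_m}) :
    (m <= 4)%N -> (m <= dim E)%N ->
    double_quotient_char T chiA DA ->
    double_quotient_char (swap_balanced T) chiB DB ->
    double_quotient_char (rot_balanced (rot_balanced T)) chiC DC ->
  False.
Proof.
move=> m4 mE hA hB hC.
have chiAB := double_quotient_char_eq m4 mE hA hB.
have chiAC : chiA =1 chiC.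
  exact: (@double_quotient_char_eq _ _ _ (swap_balanced (rot_balanced (rot_balanced T)))
    _ _ _ _ m4 mE hA hC).
have [lchi dA _] := hA; have [_ dB _] := hB; have [_ dC _] := hC.
have [M [ME' dM]] := linear_functional_kernel fullv lchi; rewrite dimvf in dM.
have ME y : (y \in M) = (chiA y == 0) by rewrite ME' memvf.
have MA y : y \in M -> forall a : 'rV_m, a *m actA T y \in DA.
  by rewrite ME => /eqP y0 a; apply: double_quotient_char_mem hA y0.
have MB y : y \in M -> forall b : 'rV_m, b *m actB T y \in DB.
  by rewrite ME chiAB => /eqP y0 b; apply: double_quotient_char_mem hB y0.
have MC y : y \in M -> forall c : 'rV_m, c *m actC T y \in DC.
  by rewrite ME chiAC => /eqP y0 c; apply: double_quotient_char_mem hC y0.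
have [K [KM dK dMK KD]] := kills_double_quotient m4 mE hA ME.
have dMK' := dimvS KM.
have [MM|] := pselect (forall y z, y \in M -> z \in M ->
    forall a : 'rV_m, a *m actA T y *m actA T z = 0).
  have [m4' | m3] := eqVneq m 4%N.
    subst m; apply: (@square_zero_absurd _ _ T M DA DB DC) => //.
    - exact: leq_trans mE dM.
    - by move: dA; rewrite addn2.
    - by move: dB; rewrite addn2.
    - by move: dC; rewrite addn2.
  have [g DAg] : exists g, (DA <= <[g]>)%VS.
    have [|dA0] := posnP (\dim DA).
      by move=> /eqP; rewrite dimv_eq0 => /eqP ->; exists 0; apply: sub0v.
    have [g gD g0] := vspace_neq0 dA0; exists g.
    suff /eqP <- : <[g]>%VS == DA by apply: subvv.
    by rewrite eqEdim -memvE gD dim_vline g0; lia.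
  apply: (@balanced_line_absurd _ _ _ T M g DB) => //; last by lia.
  by move=> y yM a; apply: (subvP DAg); apply: MA.
move=> MMn.
have [x [u [xM uM [a0 a0ux]]]] : exists x u, [/\ x \in M, u \in M &
    exists a : 'rV_m, a *m actA T u *m actA T x != 0].
  apply: contrapT => no; apply: MMn => u x uM xM a; apply/eqP/negPn/negP => ne.
  by apply: no; exists x, u; split=> //; exists a.
have Kx y (a : 'rV_m) : y \in K -> a *m actA T y *m actA T x = 0.
  by move=> yK; rewrite actA_mulC KD ?MA.
have cut (D : {vspace 'rV[F]_m}) (X : 'M[F]_m) (e : 'rV_m) :
    (\dim D + 2 <= m)%N -> e \in D -> e *m X != 0 ->
  exists g, forall v, v \in D -> v *m X = 0 -> v \in <[g]>%VS.
  move=> dD eD eX; have [W WE] := kernel_vspace X.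
  have dDW : (\dim (D :&: W) <= 1)%N.
    rewrite -ltnS; have d2 : (\dim D <= 2)%N by lia.
    apply: leq_trans d2; rewrite ltnNge; apply: contra eX => dle.
    have DW : (D :&: W == D)%VS by rewrite eqEdim capvSl.
    by apply/eqP/WE; move: eD; rewrite -(eqP DW) memv_cap => /andP[].
  have [d0|] := posnP (\dim (D :&: W)).
    exists 0 => v vD /WE vW; have : v \in (D :&: W)%VS by rewrite memv_cap vD.
    by move/eqP: d0; rewrite dimv_eq0 => /eqP ->; rewrite memv0 => /eqP->.
  move=> /vspace_neq0[g gD g0]; exists g => v vD /WE vW.
  suff /eqP -> : <[g]>%VS == (D :&: W)%VS by rewrite memv_cap vD.
  by rewrite eqEdim -memvE gD dim_vline g0.
have [g gP] := cut DA (actA T x) _ dA (MA u uM a0) a0ux.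
have [b0 b0ux] : exists b : 'rV_m, b *m actB T u *m actB T x != 0.
  apply: contrapT => no; move/eqP: a0ux; apply; apply: (formA_nondeg T) => b c.
  rewrite [form _ _ _ _]formAB [form _ _ _ _]formAB (@actA_mulC _ _ _ (swap_balanced T)).
  suff -> : b *m actB T u *m actB T x = 0 by apply: form0m.
  by apply/eqP/negPn/negP => ne; apply: no; exists b.
have [h hP] := cut DB (actB T x) _ dB (MB u uM b0) b0ux.
apply: (@balanced_line_absurd _ _ _ T K g <[h]>%VS) => //.
- by move=> y yK a; apply: gP; [apply/MA/(subvP KM) | apply: Kx].
- move=> y yK b; apply: hP; first exact/MB/(subvP KM).
  apply: (formB_nondeg T) => a c.
  by rewrite -formAB -formAB actA_mulC Kx ?form0l.
- by rewrite dim_vline; apply: leq_ltn_trans (leq_b1 _) _.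
Qed.

Lemma annihilating_roots (F : closedFieldType) (m : nat) (X : 'M[F]_m) :
  exists rs : seq F, forall v : 'rV_m, foldr (fun r w => w *m (X - r%:M)) v rs = 0.
Proof.
case: m X => [|n] X; first by exists [::] => v; apply: thinmx0.
have [rs /= rsE] := closed_field_poly_normal (char_poly X); exists rs => v.
have prodE (s : seq F) (w : 'rV_n.+1) :
    foldr (fun r w => w *m (X - r%:M)) w s = w *m horner_mx X (\prod_(z <- s) ('X - z%:P)).
  elim: s => [|r s IHs] /=; first by rewrite big_nil rmorph1 mulmx1.
  rewrite big_cons mulrC rmorphM rmorphB /= horner_mx_X horner_mx_C -mulmxE mulmxA -IHs.
  by [].
have := Cayley_Hamilton X; rewrite rsE (monicP (char_poly_monic X)) scale1r prodE => ->.
exact: mulmx0.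
Qed.

Section CyclicOrCharacter.
Variables (F : closedFieldType) (m : nat) (E : vectType F) (T : balanced_form m E).
Implicit Types (S W : {vspace 'rV[F]_m}).

Definition submodule W := forall y v, v \in W -> v *m actA T y \in W.

Lemma submoduleB W y v k : submodule W -> v \in W -> v *m (actA T y - k%:M) \in W.
Proof. by move=> subW vW; rewrite mulmxBr mul_mx_scalar memvB ?memvZ ?subW. Qed.

Lemma exists_simple_quotient S : submodule S -> (0 < \dim S)%N ->
  exists S', [/\ submodule S', (S' <= S)%VS, \dim S = (\dim S').+1 &
    exists chi : E -> F, forall y v, v \in S -> v *m actA T y - chi y *: v \in S'].
Proof.
move=> subS S0.
pose Q n := `[<exists W, [/\ submodule W, (W <= S)%VS, \dim W = n & (n < \dim S)%N]>].
have exQ : exists n, Q n.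
  exists 0%N; apply/asboolP; exists 0%VS; split; rewrite ?sub0v ?dimv0 // => y v.
  by rewrite !memv0 => /eqP->; rewrite mul0mx.
have ubQ n : Q n -> (n <= \dim S)%N by case/asboolP => W [_ _ _ /ltnW].
case: (ex_maxnP exQ ubQ) => n /asboolP[S' [subS' S'S dS' nS]] nmax.
have max W : submodule W -> (W <= S)%VS -> (\dim W < \dim S)%N -> (\dim W <= \dim S')%N.
  by move=> subW WS dW; rewrite dS'; apply: nmax; apply/asboolP; exists W.
have eig y : exists l, forall v, v \in S -> v *m (actA T y - l%:M) \in S'.
  apply: contrapT => no.
  have onto l s : s \in S -> exists2 t, t \in S & s - t *m (actA T y - l%:M) \in S'.
    pose P w := w \in S /\ exists2 t, t \in S & w - t *m (actA T y - l%:M) \in S'.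
    have [||W WE] := @closed_pred_vspace _ _ P.
    - by split; [exact: mem0v | exists 0; rewrite ?mul0mx ?subrr ?mem0v].
    - move=> k u v [uS [t tS ut]] [vS [t' t'S vt']].
      split; first by rewrite memvD ?memvZ.
      exists (k *: t + t'); first by rewrite memvD ?memvZ.
      rewrite (_ : _ - _ = k *: (u - t *m (actA T y - l%:M)) + (v - t' *m (actA T y - l%:M))).
        by rewrite memvD ?memvZ.
      by rewrite mulmxDl -scalemxAl scalerBr opprD addrACA.
    have WS : (W <= S)%VS by apply/subvP => w /WE[].
    have S'W : (S' <= W)%VS.
      apply/subvP => w wS'; apply/WE; split; first exact: (subvP S'S).
      by exists 0; rewrite ?mul0mx ?subrr ?subr0 ?mem0v.
    have subW : submodule W.
      move=> z w /WE[wS [t tS wt]]; apply/WE; split; first exact: subS.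
      exists (t *m actA T z); first exact: subS.
      have := subS' z _ wt; rewrite mulmxBl !mulmxBr !mul_mx_scalar mulmxBl -scalemxAl.
      by rewrite actA_mulC.
    have [dW|dW] := ltnP (\dim W) (\dim S); last first.
      have /eqP WE' : W == S by rewrite eqEdim WS dW.
      by rewrite -{1}WE' => /WE[].
    exfalso; apply: no; exists l => v vS.
    have /eqP -> : S' == W by rewrite eqEdim S'W max.
    apply/WE; split; first exact: submoduleB.
    by exists v; rewrite ?subrr ?mem0v.
  have [rs rs0] := annihilating_roots (actA T y).
  have onto_rs s : s \in S ->
      exists2 t, t \in S & s - foldr (fun r w => w *m (actA T y - r%:M)) t rs \in S'.
    elim: rs {rs0} s => [|r rs IHrs] s sS /=; first by exists s; rewrite ?subrr ?mem0v.
    have [t' t'S st'] := onto r s sS; have [t tS t't] := IHrs t' t'S; exists t => //.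
    have := submoduleB y r subS' t't => d; have := memvD st' d.
    by rewrite mulmxBl addrA subrK.
  have [|v vS /negP[]] := @subv_proper _ _ S' S; first by rewrite dS'.
  by have [t _] := onto_rs v vS; rewrite rs0 subr0.
have [chi chiP] := choice eig.
have dS : \dim S = (\dim S').+1.
  apply/eqP; rewrite eqn_leq dS' nS andbT leqNgt; apply/negP => lt.
  have [|v vS vS'] := @subv_proper _ _ S' S; first by rewrite dS'.
  have := dimv_addv_line vS'; rewrite dS' => dW.
  suff : (\dim (S' + <[v]>)%VS <= \dim S')%N by rewrite dW dS' ltnn.
  apply: max; rewrite ?dW ?subv_add ?S'S -?memvE //.
  move=> y _ /memv_addP[s sS' [_ /vlineP[k ->] ->]].
  rewrite mulmxDl -scalemxAl -[v *m _](subrK (v *m (chi y)%:M)) -mulmxBr mul_mx_scalar.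
  rewrite scalerDr addrA.
  rewrite memv_add ?memvD ?memvZ ?memv_line ?subS' ?chiP //.
by exists S'; split=> //; exists chi => y v vS; rewrite -mul_mx_scalar -mulmxBr chiP.
Qed.

Lemma cyclic_or_double_quotient_char :
  (exists a, forall W, submodule W -> a \in W -> forall v, v \in W) \/
  exists chi D, double_quotient_char T chi D.
Proof.
pose gen S := exists a, forall W, submodule W -> a \in W -> (S <= W)%VS -> forall v, v \in W.
suff step n S : \dim S = n -> submodule S -> gen S ->
    gen 0%VS \/ exists chi D, double_quotient_char T chi D.
  have [||[a ga]|] := step _ fullv erefl; last by right.
  - by move=> y v _; rewrite memvf.
  - by exists 0 => W _ _ fW v; rewrite (subvP fW) ?memvf.
  - by left; exists a => W subW aW; apply: ga => //; apply: sub0v.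
elim: n S => [|n IHn] S dS subS genS.
  by left; move/eqP: dS; rewrite dimv_eq0 => /eqP <-.
have [|S' [subS' S'S dSS' [chi chiS]]] := exists_simple_quotient subS; first by rewrite dS.
have dS' : \dim S' = n by move: dSS'; rewrite dS => -[].
have [v vS vS'] : exists2 v, v \in S & v \notin S' by apply: subv_proper; rewrite dS dS'.
have SE : S = (S' + <[v]>)%VS.
  by apply/eqP; rewrite eq_sym eqEdim subv_add S'S -memvE vS dimv_addv_line // dS dS' leqnn.
have [a ga] := genS.
(* [D] is the submodule generated by [S'] and the maximal ideal [ker chi] applied to [a];
   if it has codimension at most 1, then [a] or [a + v] generates modulo [S']. *)
pose above W := [/\ submodule W, (S' <= W)%VS &
  forall y, a *m actA T y - chi y *: a \in W].
have [||D DE] := @closed_pred_vspace _ _ (fun w => forall W, above W -> w \in W).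
- by move=> W _; apply: mem0v.
- by move=> k u w uP wP W aW; rewrite memvD ?memvZ ?uP ?wP.
have D_min W : above W -> (D <= W)%VS by move=> aW; apply/subvP => w /DE; apply.
have subD : submodule D.
  move=> y w /DE wP; apply/DE => W aW; have [subW _ _] := aW; exact/subW/wP.
have S'D : (S' <= D)%VS by apply/subvP => w wS'; apply/DE => W [_ /subvP S'W _]; apply: S'W.
have aD y : a *m actA T y - chi y *: a \in D by apply/DE => W [].
have chiD y (w : 'rV_m) : w *m actA T y - chi y *: w \in D.
  have [||W WE] := @closed_pred_vspace _ _
      (fun w : 'rV_m => forall y, w *m actA T y - chi y *: w \in D).
  - by move=> z; rewrite mul0mx scaler0 subrr mem0v.
  - move=> k u u' uP uP' z; rewrite mulmxDl -scalemxAl scalerDr opprD addrACA.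
    by rewrite scalerA mulrC -scalerA -scalerBr memvD ?memvZ.
  apply/WE: y; apply: ga.
  - move=> z u /WE uP; apply/WE => y; rewrite actA_mulC scalemxAl -mulmxBl; exact: subD.
  - exact/WE.
  - apply/subvP => u uS; apply/WE => y; apply: (subvP S'D); exact: chiS.
have [dD|dD] := leqP (\dim D + 2) m.
  right; exists chi, D; split=> // k y z.
  have [|w _ wD] := @subv_proper _ _ D (@fullv _ 'rV[F]_m); first by rewrite dim_fullv_rV; lia.
  apply/eqP; rewrite -subr_eq0; apply: contraNT wD => nz.
  rewrite -[w]scale1r -(mulVf nz) -scalerA memvZ //.
  have := memvB (memvD (memvZ k (chiD y w)) (chiD z w)) (chiD (k *: y + z) w).
  have /= -> := mulmx_actA_linear T w k y z; set p := w *m _; set q := w *m _.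
  suff -> : k *: (p - chi y *: w) + (q - chi z *: w) - (k *: p + q - chi (k *: y + z) *: w) =
      (chi (k *: y + z) - (k * chi y + chi z)) *: w by [].
  rewrite scalerBr (addrACA (k *: p)) -opprD scalerA -scalerDl opprB [LHS]addrC addrA subrK.
  by rewrite -scalerBl.
apply: (IHn S' dS' subS').
have [ga'|] := pselect (forall W, submodule W -> a \in W -> (S' <= W)%VS -> forall v, v \in W).
  by exists a.
move=> nga; have [W [subW aW S'W nfull]] : exists W, [/\ submodule W, a \in W, (S' <= W)%VS &
    exists w, w \notin W].
  apply: contrapT => no; apply: nga => W subW aW S'W w; apply: contraT => nw.
  by case: no; exists W; split=> //; exists w.
have aW' : above W by split=> // y; rewrite memvB ?memvZ ?subW.
have DW : D = W.
  apply/eqP; rewrite eqEdim D_min //=.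
  have [w wW] := nfull; have := dimv_addv_line wW.
  have := dimvS (subvf (W + <[w]>)%VS); rewrite dim_fullv_rV; lia.
exists (a + v) => W2 subW2 avW2 S'W2.
have aW2 : a \in W2.
  suff /subvP DW2 : (D <= W2)%VS by apply: DW2; rewrite DW.
  apply: D_min; split=> // y.
  have := memvB (memvB (subW2 y _ avW2) (memvZ (chi y) avW2)) (subvP S'W2 _ (chiS y v vS)).
  by rewrite mulmxDl scalerDr opprD addrACA addrK.
apply: ga => //; rewrite SE subv_add S'W2 -memvE /=.
by have := memvB avW2 aW2; rewrite addrC addKr.
Qed.

Lemma degenerate_double_quotient_char :
  (forall a, exists2 b, b != 0 & forall c, form T a b c = 0) ->
  exists chi D, double_quotient_char T chi D.
Proof.
move=> degen; have [[a ga]|//] := cyclic_or_double_quotient_char.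
have [b b0 ab] := degen a.
have [||W WE] := @closed_pred_vspace _ _ (fun v => forall c, form T v b c = 0).
- by move=> c; apply: form0l.
- by move=> k u v uP vP c; rewrite (formA_linear T b c k) uP vP scaler0 addr0.
case/eqP: b0; apply: (formB_nondeg T) => v c; apply/WE: c; apply: ga.
- by move=> y u /WE vP; apply/WE => c; rewrite formAB formBC.
- exact/WE.
Qed.

End CyclicOrCharacter.

(** * Semicontinuity *)

Section Semicontinuity.
Variable K : numFieldType.

Lemma cvg_sumr (I : Type) (s : seq I) (f : I -> nat -> K) (l : I -> K) :
  (forall i, f i n @[n --> \oo] --> l i) ->
  \sum_(i <- s) f i n @[n --> \oo] --> \sum_(i <- s) l i.
Proof.
move=> fl; elim: s => [|i s IHs].
  under eq_cvg do rewrite big_nil; rewrite big_nil; exact: cvg_cst.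
under eq_cvg do rewrite big_cons; rewrite big_cons; exact: cvgD.
Qed.

Lemma cvg_prodr (I : Type) (s : seq I) (f : I -> nat -> K) (l : I -> K) :
  (forall i, f i n @[n --> \oo] --> l i) ->
  \prod_(i <- s) f i n @[n --> \oo] --> \prod_(i <- s) l i.
Proof.
move=> fl; elim: s => [|i s IHs].
  under eq_cvg do rewrite big_nil; rewrite big_nil; exact: cvg_cst.
under eq_cvg do rewrite big_cons; rewrite big_cons; exact: cvgM.
Qed.

Lemma cvg_det (p : nat) (M : nat -> 'M[K]_p) (N : 'M[K]_p) :
  (forall i j, M n i j @[n --> \oo] --> N i j) -> \det (M n) @[n --> \oo] --> \det N.
Proof.
move=> MN; apply: cvg_sumr => s; apply: cvgM; first exact: cvg_cst.
by apply: cvg_prodr => i.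
Qed.

Lemma cvg_mulmx (p q r s : nat) (L : 'M[K]_(r, p)) (R : 'M[K]_(q, s))
    (M : nat -> 'M[K]_(p, q)) (N : 'M[K]_(p, q)) :
    (forall i j, M n i j @[n --> \oo] --> N i j) ->
  forall i j, (L *m M n *m R) i j @[n --> \oo] --> (L *m N *m R) i j.
Proof.
move=> MN i j; under eq_cvg do rewrite mxE; rewrite mxE.
apply: cvg_sumr => k; apply: cvgM; last exact: cvg_cst.
under eq_cvg do rewrite mxE; rewrite mxE.
by apply: cvg_sumr => l; apply: cvgM => //; exact: cvg_cst.
Qed.

Lemma mxrank_lower_semicontinuous (p q : nat) (M : nat -> 'M[K]_(p, q)) (N : 'M[K]_(p, q)) :
    (forall i j, M n i j @[n --> \oo] --> N i j) ->
  \forall n \near \oo, (\rank N <= \rank (M n))%N.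
Proof.
move=> MN.
have /row_fullP[L LN] := col_base_full N; have /row_freeP[R NR] := row_base_free N.
have detN : \det (L *m N *m R) = 1.
  have := congr1 (mulmx L) (mulmx_base N); rewrite mulmxA LN mul1mx => <-.
  by rewrite NR det1.
have := cvg_det (cvg_mulmx (L := L) (R := R) MN); rewrite detN.
move=> /cvgr_neq0/(_ (oner_neq0 K)); apply: filterS => n nz.
have : \rank (L *m M n *m R) = \rank N by apply: mxrank_unit; rewrite unitmxE unitfE.
move=> <-; apply: leq_trans (mxrankM_maxl _ _) (mxrankM_maxr _ _).
Qed.

End Semicontinuity.

Section TensorForm.
Variables (K : numFieldType) (m : nat).
Implicit Types (T : tensor K m) (a b c : 'rV[K]_m).

Definition tri T a b c : K^o :=
  \sum_(x : 'I_m * 'I_m * 'I_m) a 0 x.1.1 * b 0 x.1.2 * c 0 x.2 * T x.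

Lemma tri_linearA T b c : linear (fun a => tri T a b c).
Proof.
move=> k u v; rewrite /tri scaler_sumr -big_split; apply: eq_bigr => x _ /=.
by rewrite !mxE !mulrDl -!mulrA.
Qed.

Lemma tri_linearB T a c : linear (fun b => tri T a b c).
Proof.
move=> k u v; rewrite /tri scaler_sumr -big_split; apply: eq_bigr => x _ /=.
rewrite !mxE mulrDr !mulrDl; congr (_ + _).
by rewrite /GRing.scale /= mulrCA -!mulrA.
Qed.

Lemma tri_linearC T a b : linear (fun c => tri T a b c).
Proof.
move=> k u v; rewrite /tri scaler_sumr -big_split; apply: eq_bigr => x _ /=.
rewrite !mxE mulrDr !mulrDl; congr (_ + _).
by rewrite /GRing.scale /= mulrCA -!mulrA.
Qed.

Lemma tri_sum T a b c :
  tri T a b c = \sum_i \sum_j \sum_k a 0 i * b 0 j * c 0 k * T (i, j, k).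
Proof. by rewrite pair_bigA pair_bigA; apply: eq_bigr => -[[i j] k] _. Qed.

Lemma tri_flatA T a b c : tri T a b c = (b *m flatA T a *m c^T) 0 0.
Proof.
rewrite tri_sum exchange_big mxE /=.
under [RHS]eq_bigr => k _ do rewrite !mxE mulr_suml.
rewrite [RHS]exchange_big /=; apply: eq_bigr => j _; rewrite exchange_big /=.
apply: eq_bigr => k _; rewrite mxE mulr_sumr mulr_suml; apply: eq_bigr => i _.
by rewrite mulrA [b 0 j * _]mulrC [RHS]mulrAC.
Qed.

Lemma tri_flatB T a b c : tri T a b c = (a *m flatB T b *m c^T) 0 0.
Proof.
rewrite tri_sum mxE /=.
under [RHS]eq_bigr => k _ do rewrite !mxE mulr_suml.
rewrite [RHS]exchange_big /=; apply: eq_bigr => i _; rewrite exchange_big /=.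
apply: eq_bigr => k _; rewrite mxE mulr_sumr mulr_suml; apply: eq_bigr => j _.
by rewrite mulrA [RHS]mulrAC.
Qed.

Lemma tri_flatC T a b c : tri T a b c = (a *m flatC T c *m b^T) 0 0.
Proof.
rewrite tri_sum mxE /=.
under [RHS]eq_bigr => j _ do rewrite !mxE mulr_suml.
rewrite [RHS]exchange_big /=; apply: eq_bigr => i _.
apply: eq_bigr => j _; rewrite mxE mulr_sumr mulr_suml; apply: eq_bigr => k _.
by rewrite mulrA [RHS]mulrAC [a 0 i * b 0 j * _]mulrAC.
Qed.

Lemma delta_bilinear (A : 'M[K]_m) j k :
  ((delta_mx 0 j : 'rV_m) *m A *m (delta_mx 0 k : 'rV_m)^T) 0 0 = A j k.
Proof. by rewrite -rowE trmx_delta -colE !mxE. Qed.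

Lemma concise_nondegenerate T : concise T ->
  [/\ forall a, (forall b c, tri T a b c = 0) -> a = 0,
      forall b, (forall a c, tri T a b c = 0) -> b = 0 &
      forall c, (forall a b, tri T a b c = 0) -> c = 0].
Proof.
case=> iA iB iC; split=> [a a0|b b0|c c0].
- apply: iA; apply/matrixP => j k; rewrite -delta_bilinear -tri_flatA a0.
  by rewrite mxE big1 // => i _; rewrite mxE mul0r.
- apply: iB; apply/matrixP => i k; rewrite -delta_bilinear -tri_flatB b0.
  by rewrite mxE big1 // => j _; rewrite mxE mul0r.
- apply: iC; apply/matrixP => i j; rewrite -delta_bilinear -tri_flatC c0.
  by rewrite mxE big1 // => k _; rewrite mxE mul0r.
Qed.

Lemma degenerate_kernel (A : 'M[K]_m) : \rank A <> m ->
  exists2 b : 'rV_m, b != 0 & forall c : 'rV_m, (b *m A *m c^T) 0 0 = 0.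
Proof.
move=> rX; have : kermx A != 0 by rewrite kermx_eq0; apply/eqP.
by case/rowV0Pn => b /sub_kermxP bX b0; exists b => // c; rewrite bX mul0mx mxE.
Qed.

End TensorForm.

Lemma linear_delta_ext (K : fieldType) (m : nat) (V : lmodType K) (f g : 'rV[K]_m -> V) :
    linear f -> linear g -> (forall i, f (delta_mx 0 i) = g (delta_mx 0 i)) -> f =1 g.
Proof.
move=> lf lg fg a.
pose fL : {linear 'rV[K]_m -> V} := HB.pack f (GRing.isLinear.Build _ _ _ *:%R _ lf).
pose gL : {linear 'rV[K]_m -> V} := HB.pack g (GRing.isLinear.Build _ _ _ *:%R _ lg).
rewrite -[f a]/(fL a) -[g a]/(gL a) (row_sum_delta a) !linear_sum.
by apply: eq_bigr => i _; rewrite !linearZ; congr (_ *: _); apply: fg.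
Qed.

Lemma linear_mulmxr (K : fieldType) (p q : nat) (V : lmodType K) (X : 'M[K]_(p, q))
    (f : 'rV[K]_q -> V) : linear f -> linear (fun a => f (a *m X)).
Proof. by move=> lf k u v; rewrite mulmxDl -scalemxAl lf. Qed.

Section BalancedOperators.
Variables (K : numFieldType) (m : nat).
Implicit Types (T : tensor K m) (a b c : 'rV[K]_m).

Definition triples := (m * m + (m * m + m * m))%N.
Implicit Types x : 'rV[K]_triples.

Definition opA x : 'M[K]_m := vec_mx (lsubmx x).
Definition opB x : 'M[K]_m := vec_mx (lsubmx (rsubmx x)).
Definition opC x : 'M[K]_m := vec_mx (rsubmx (rsubmx x)).

Lemma opA_linear : linear opA.
Proof. by move=> k u v; rewrite /opA !linearP. Qed.

Lemma opB_linear : linear opB.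
Proof. by move=> k u v; rewrite /opB !linearP. Qed.

Lemma opC_linear : linear opC.
Proof. by move=> k u v; rewrite /opC !linearP. Qed.

Lemma ops_eq0 x : opA x = 0 -> opB x = 0 -> opC x = 0 -> x = 0.
Proof.
move=> /(canRL vec_mxK) xA /(canRL vec_mxK) xB /(canRL vec_mxK) xC.
by rewrite -[x]hsubmxK -[rsubmx x]hsubmxK xA xB xC !linear0 !row_mx0.
Qed.

Definition balanced T x := forall a b c,
  tri T (a *m opA x) b c = tri T a (b *m opB x) c /\
  tri T a (b *m opB x) c = tri T a b (c *m opC x).

Definition balance_defect T x (j : bool * ('I_m * 'I_m * 'I_m)) : K^o :=
  let a := delta_mx 0 j.2.1.1 in let b := delta_mx 0 j.2.1.2 in let c := delta_mx 0 j.2.2 in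
  if j.1 then tri T (a *m opA x) b c - tri T a (b *m opB x) c
  else tri T a (b *m opB x) c - tri T a b (c *m opC x).

Lemma comp_mul_linear (V : lmodType K) (op : V -> 'M[K]_m) (f : 'rV[K]_m -> K^o) (a : 'rV_m) :
  linear op -> linear f -> linear (fun y => f (a *m op y)).
Proof. by move=> lop lf k u v; rewrite lop mulmxDr -scalemxAr lf. Qed.

Lemma balance_defect_linear T j : linear (fun x => balance_defect T x j).
Proof.
move=> k u v; rewrite /balance_defect.
set a := delta_mx _ _; set b := delta_mx _ _; set c := delta_mx _ _.
have /= lA := comp_mul_linear a opA_linear (tri_linearA T b c) k u v.
have /= lB := comp_mul_linear b opB_linear (tri_linearB T a c) k u v.
have /= lC := comp_mul_linear c opC_linear (tri_linearC T a b) k u v.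
by case: j.1; rewrite ?lA lB ?lC scalerBr opprD addrACA.
Qed.

Definition balance_mx T : 'M[K]_(triples, #|{: bool * ('I_m * 'I_m * 'I_m)}|) :=
  \matrix_(i, j) balance_defect T (delta_mx 0 i) (enum_val j).

Lemma mul_balance_mx T x j : (x *m balance_mx T) 0 j = balance_defect T x (enum_val j).
Proof.
move: x; apply: (@linear_delta_ext K _ K^o (fun x => (x *m balance_mx T) 0 j)
  (fun x => balance_defect T x (enum_val j))).
- by move=> k u v; rewrite mulmxDl -scalemxAl !mxE.
- exact: balance_defect_linear.
by move=> i; rewrite -rowE !mxE.
Qed.

Lemma trilinear_delta_ext (f g : 'rV[K]_m -> 'rV[K]_m -> 'rV[K]_m -> K^o) :
    (forall b c, linear (f ^~ b ^~ c)) -> (forall b c, linear (g ^~ b ^~ c)) ->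
    (forall a c, linear (fun b => f a b c)) -> (forall a c, linear (fun b => g a b c)) ->
    (forall a b, linear (f a b)) -> (forall a b, linear (g a b)) ->
    (forall i j k, f (delta_mx 0 i) (delta_mx 0 j) (delta_mx 0 k) =
                   g (delta_mx 0 i) (delta_mx 0 j) (delta_mx 0 k)) ->
  forall a b c, f a b c = g a b c.
Proof.
move=> fA gA fB gB fC gC fg a b c.
apply: (linear_delta_ext (fA b c) (gA b c)) => i.
apply: (linear_delta_ext (fB _ c) (gB _ c)) => j.
exact: linear_delta_ext (fC _ _) (gC _ _) _ c.
Qed.

Lemma balance_mx_eq0 T x : balanced T x <-> x *m balance_mx T = 0.
Proof.
split=> [xT|x0].
  apply/rowP => j; rewrite mul_balance_mx mxE /balance_defect.
  by case: (enum_val j).1; [rewrite (xT _ _ _).1 | rewrite (xT _ _ _).2]; rewrite subrr.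
have xj j : balance_defect T x j = 0.
  by have := mul_balance_mx T x (enum_rank j); rewrite x0 mxE enum_rankK.
move=> a b c; split.
- apply: (@trilinear_delta_ext (fun a b c => tri T (a *m opA x) b c)
    (fun a b c => tri T a (b *m opB x) c)) => [? ?|? ?|? ?|? ?|? ?|? ?|i j k].
  + exact: linear_mulmxr (tri_linearA _ _ _).
  + exact: tri_linearA.
  + exact: tri_linearB.
  + exact: linear_mulmxr (tri_linearB _ _ _).
  + exact: tri_linearC.
  + exact: tri_linearC.
  + by apply/eqP; rewrite -subr_eq0; apply/eqP; exact: (xj (true, (i, j, k))).
- apply: (@trilinear_delta_ext (fun a b c => tri T a (b *m opB x) c)
    (fun a b c => tri T a b (c *m opC x))) => [? ?|? ?|? ?|? ?|? ?|? ?|i j k].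
  + exact: tri_linearA.
  + exact: tri_linearA.
  + exact: linear_mulmxr (tri_linearB _ _ _).
  + exact: tri_linearB.
  + exact: tri_linearC.
  + exact: linear_mulmxr (tri_linearC _ _ _).
  + by apply/eqP; rewrite -subr_eq0; apply/eqP; exact: (xj (false, (i, j, k))).
Qed.

Lemma cvg_tri (u : nat -> tensor K m) T a b c : tensor_cvg u T ->
  tri (u n) a b c @[n --> \oo] --> tri T a b c.
Proof. by move=> uT; apply: cvg_sumr => x; apply: cvgM; [exact: cvg_cst | exact: uT]. Qed.

Lemma cvg_balance_mx (u : nat -> tensor K m) T : tensor_cvg u T -> forall i j,
  balance_mx (u n) i j @[n --> \oo] --> balance_mx T i j.
Proof.
move=> uT i j; under eq_cvg do rewrite mxE; rewrite mxE /balance_defect.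
by case: (enum_val j).1; apply: cvgB; apply: cvg_tri.
Qed.

End BalancedOperators.

Section RankDecomposition.
Variables (K : numFieldType) (m : nat).
Implicit Types (T : tensor K m).

Definition factor_mx s (a : 'I_s -> 'cV[K]_m) : 'M[K]_(m, s) := \matrix_(i, l) a l i 0.

Lemma tri_decomposition s (a b c : 'I_s -> 'cV[K]_m) (x y z : 'rV[K]_m) :
  tri (\sum_(l < s) pure_tensor (a l) (b l) (c l)) x y z =
  \sum_l (x *m factor_mx a) 0 l * (y *m factor_mx b) 0 l * (z *m factor_mx c) 0 l.
Proof.
rewrite tri_sum.
under [RHS]eq_bigr => l _ do rewrite !mxE big_distrlr /= mulr_suml.
rewrite [RHS]exchange_big; apply: eq_bigr => i _ /=.
under [RHS]eq_bigr => l _ do rewrite mulr_suml.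
rewrite [RHS]exchange_big; apply: eq_bigr => j _ /=.
under [RHS]eq_bigr => l _ do rewrite mulr_sumr.
rewrite [RHS]exchange_big; apply: eq_bigr => k _ /=.
rewrite sum_ffunE mulr_sumr; apply: eq_bigr => l _; rewrite ffunE !mxE /=.
by rewrite mulrACA; congr (_ * _); rewrite mulrACA.
Qed.

Lemma balanced_dim_decomposition (a b c : 'I_m -> 'cV[K]_m) :
    factor_mx a \in unitmx -> factor_mx b \in unitmx -> factor_mx c \in unitmx ->
  (m + \rank (balance_mx (\sum_(l < m) pure_tensor (a l) (b l) (c l))%R) <= triples m)%N.
Proof.
move=> ua ub uc; set T := \sum_(l < m) _.
pose conj (P : 'M[K]_m) (l : 'rV[K]_m) := P *m diag_mx l *m invmx P.
pose f (l : 'rV[K]_m) : 'rV[K]_(triples m) := row_mx (mxvec (conj (factor_mx a) l))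
  (row_mx (mxvec (conj (factor_mx b) l)) (mxvec (conj (factor_mx c) l))).
have conj_linear P : linear (conj P).
  by move=> k u v; rewrite /conj linearP mulmxDr mulmxDl -scalemxAr -scalemxAl.
have f_linear : linear f.
  by move=> k u v; rewrite /f !conj_linear !linearP !scale_row_mx !add_row_mx.
pose fL : {linear 'rV[K]_m -> 'rV[K]_(triples m)} :=
  HB.pack f (GRing.isLinear.Build _ _ _ *:%R _ f_linear).
have conjE P x l j : P \in unitmx -> (x *m conj P l *m P) 0 j = (x *m P) 0 j * l 0 j.
  by move=> uP; rewrite /conj !mulmxA mulmxKV // mul_mx_diag mxE.
have free : row_free (lin1_mx fL).
  apply: inj_row_free => v; rewrite mul_rV_lin1 => /(congr1 lsubmx).
  rewrite [lsubmx _]row_mxKl linear0 => /(congr1 vec_mx); rewrite mxvecK linear0 => cv.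
  have dv : diag_mx v = 0.
    have := congr1 (fun X => invmx (factor_mx a) *m X *m factor_mx a) cv.
    by rewrite /conj !mulmxA mulVmx // mul1mx mulmxKV // mulmx0 mul0mx.
  apply/rowP => j; have := congr1 (fun X : 'M[K]_m => X j j) dv.
  by rewrite !mxE eqxx mulr1n.
have null : lin1_mx fL *m balance_mx T = 0.
  apply/row_matrixP => i; rewrite rowE row0 mulmxA mul_rV_lin1.
  apply/balance_mx_eq0 => x y z; rewrite /fL /= /f /opA /opB /opC.
  rewrite !row_mxKr !row_mxKl !mxvecK /T !tri_decomposition.
  split; apply: eq_bigr => l _; rewrite !conjE // -!mulrA; congr (_ * _).
    by rewrite mulrCA.
  by congr (_ * _); exact: mulrC.
by have := mulmx0_rank_max null; rewrite (eqP free).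
Qed.

Definition flattening (g : 'I_m -> 'I_m * 'I_m -> 'I_m * 'I_m * 'I_m) T :
    'M[K]_(m, #|{: 'I_m * 'I_m}|) :=
  \matrix_(i, j) T (g i (enum_val j)).

Definition slotA (i : 'I_m) (p : 'I_m * 'I_m) := (i, p.1, p.2).
Definition slotB (i : 'I_m) (p : 'I_m * 'I_m) := (p.1, i, p.2).
Definition slotC (i : 'I_m) (p : 'I_m * 'I_m) := (p.1, p.2, i).

Lemma flattening_free g T (flat : tensor K m -> 'rV[K]_m -> 'M[K]_m) :
    (forall f p, flat T f p.1 p.2 = \sum_i f 0 i * T (g i p)) ->
  injective (flat T) -> \rank (flattening g T) = m.
Proof.
move=> flatE inj; apply/eqP; apply: inj_row_free => v v0; apply: inj.
apply/matrixP => j k; rewrite (flatE _ (j, k)) (flatE _ (j, k)).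
rewrite [RHS]big1 => [|i _]; last by rewrite mxE mul0r.
have := congr1 (fun X : 'rV_ _ => X 0 (enum_rank (j, k))) v0; rewrite !mxE; apply: etrans.
by apply: eq_bigr => i _; rewrite mxE enum_rankK.
Qed.

Lemma concise_flattenings T : concise T ->
  [/\ \rank (flattening slotA T) = m, \rank (flattening slotB T) = m &
      \rank (flattening slotC T) = m].
Proof.
by case=> iA iB iC; split; [move: iA | move: iB | move: iC]; apply: flattening_free => f [j k];
  rewrite mxE.
Qed.

Lemma rank_flattening_factor g s (a : 'I_s -> 'cV[K]_m) T
    (rest : 'I_s -> 'I_m * 'I_m -> K) :
    (forall i p, T (g i p) = \sum_l a l i 0 * rest l p) ->
  (\rank (flattening g T) <= \rank (factor_mx a))%N.
Proof.
move=> TE; have -> : flattening g T = factor_mx a *m \matrix_(l, j) rest l (enum_val j).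
  by apply/matrixP => i j; rewrite !mxE TE; apply: eq_bigr => l _; rewrite !mxE.
exact: mxrankM_maxl.
Qed.

Lemma cvg_flattening g (u : nat -> tensor K m) T : tensor_cvg u T -> forall i j,
  flattening g (u n) i j @[n --> \oo] --> flattening g T i j.
Proof. by move=> uT i j; under eq_cvg do rewrite mxE; rewrite mxE; exact: uT. Qed.

Lemma border_rank_balanced_dim T : concise T -> limit_of_rank_at_most T m ->
  (m + \rank (balance_mx T) <= triples m)%N.
Proof.
move=> cT [u ru uT]; have [TA TB TC] := concise_flattenings cT.
have near_rank g := mxrank_lower_semicontinuous (cvg_flattening (g := g) uT).
have near_bal := mxrank_lower_semicontinuous (cvg_balance_mx uT).
have [n [uA uB uC ubal]] : exists n, [/\ (m <= \rank (flattening slotA (u n)))%N,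
    (m <= \rank (flattening slotB (u n)))%N, (m <= \rank (flattening slotC (u n)))%N &
    (\rank (balance_mx T) <= \rank (balance_mx (u n)))%N].
  have nA := near_rank slotA; have nB := near_rank slotB; have nC := near_rank slotC.
  rewrite TA in nA; rewrite TB in nB; rewrite TC in nC.
  near \oo => n; exists n.
  by split; near: n.
apply: leq_trans (_ : (m + \rank (balance_mx (u n)) <= _)%N); first by rewrite leq_add2l.
have [s [[a [b [c unE]]] _] sm] := ru n.
have pureE x : u n x = \sum_l a l x.1.1 0 * b l x.1.2 0 * c l x.2 0.
  by rewrite unE sum_ffunE; apply: eq_bigr => l _; rewrite ffunE.
have ra : (m <= \rank (factor_mx a))%N.
  apply: leq_trans uA _;
    apply: (@rank_flattening_factor _ _ _ _ (fun l p => b l p.1 0 * c l p.2 0)).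
  by move=> i p; rewrite pureE; apply: eq_bigr => l _; rewrite mulrA.
have rb : (m <= \rank (factor_mx b))%N.
  apply: leq_trans uB _;
    apply: (@rank_flattening_factor _ _ _ _ (fun l p => a l p.1 0 * c l p.2 0)).
  by move=> i p; rewrite pureE; apply: eq_bigr => l _; rewrite /= mulrA [b _ _ _ * _]mulrC.
have rc : (m <= \rank (factor_mx c))%N.
  apply: leq_trans uC _;
    apply: (@rank_flattening_factor _ _ _ _ (fun l p => a l p.1 0 * b l p.2 0)).
  by move=> i p; rewrite pureE; apply: eq_bigr => l _; rewrite /= mulrC.
have sE : s = m by apply/eqP; rewrite eqn_leq sm (leq_trans ra (rank_leq_col _)).
move: sE a b c unE {sm pureE} ra rb rc => -> a b c -> ra rb rc.
by apply: balanced_dim_decomposition; rewrite -row_free_unit -row_leq_rank.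
Unshelve.
all: by end_near.
Qed.

End RankDecomposition.

Section BalancedFormOfTensor.
Variables (K : numFieldType) (m : nat) (T : tensor K m).
Hypothesis concT : concise T.

Let kernel := row_base (kermx (balance_mx T)).
Let E := 'rV[K]_(\rank (kermx (balance_mx T))).

Let kernel_balanced (y : E) : balanced T (y *m kernel).
Proof.
apply/balance_mx_eq0; apply/sub_kermxP.
by apply: submx_trans (submxMl _ _) _; rewrite eq_row_base.
Qed.

Definition tensor_balanced_form : balanced_form m E.
Proof.
refine (@BalancedForm _ m _ (fun y : E => opA (y *m kernel)) (fun y : E => opB (y *m kernel))
  (fun y : E => opC (y *m kernel)) (tri T) _ _ _ (tri_linearA T) (tri_linearB T) (tri_linearC T)
  _ _ _ _ _ _).
- exact: linear_mulmxr (@opA_linear _ _).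
- exact: linear_mulmxr (@opB_linear _ _).
- exact: linear_mulmxr (@opC_linear _ _).
- by move=> y a b c; rewrite (kernel_balanced y a b c).1.
- by move=> y a b c; rewrite (kernel_balanced y a b c).2.
- by case: (concise_nondegenerate concT).
- by case: (concise_nondegenerate concT).
- by case: (concise_nondegenerate concT).
move=> y y0; have [ndA ndB ndC] := concise_nondegenerate concT.
have op0 (X : 'M[K]_m) : (forall a : 'rV_m, a *m X = 0) -> X = 0.
  by move=> X0; apply/row_matrixP => i; rewrite rowE X0 row0.
have yk0 : y *m kernel = 0.
  apply: ops_eq0; apply: op0 => v.
  - exact: ndA (y0 v).
  - by apply: ndB => a c; rewrite -(kernel_balanced y a v c).1 y0.
  - by apply: ndC => a b; rewrite -(kernel_balanced y a b v).2 -(kernel_balanced y a b v).1 y0.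
by apply: (row_free_inj (row_base_free (kermx (balance_mx T)))); rewrite yk0 mul0mx.
Defined.

End BalancedFormOfTensor.

Lemma minimal_border_rank_generic (K : numClosedFieldType) (m : nat) (T : tensor K m) :
  (m <= 4)%N -> minimal_border_rank T -> one_star_generic T.
Proof.
move=> m4 [cT [rT _]]; apply: contrapT => ngen.
have mE : (m <= dim ('rV[K]_(\rank (kermx (balance_mx T)))))%N.
  rewrite dim_matrix mul1r mxrank_ker; have := border_rank_balanced_dim cT rT; lia.
have [|chiA [DA hA]] := @degenerate_double_quotient_char K m _ (tensor_balanced_form cT).
  move=> a; have [|b b0 bP] := @degenerate_kernel _ _ (flatA T a).
    by move=> ra; apply: ngen; apply: Or31; exists a.
  by exists b => // c; rewrite -[LHS]/(tri T a b c) tri_flatA.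
have [|chiB [DB hB]] := @degenerate_double_quotient_char K m _
    (swap_balanced (tensor_balanced_form cT)).
  move=> b; have [|a a0 aP] := @degenerate_kernel _ _ (flatB T b).
    by move=> rb; apply: ngen; apply: Or32; exists b.
  by exists a => // c; rewrite -[LHS]/(tri T a b c) tri_flatB.
have [|chiC [DC hC]] := @degenerate_double_quotient_char K m _
    (rot_balanced (rot_balanced (tensor_balanced_form cT))).
  move=> c; have [|a a0 aP] := @degenerate_kernel _ _ (flatC T c).
    by move=> rc; apply: ngen; apply: Or33; exists c.
  by exists a => // b; rewrite -[LHS]/(tri T a b c) tri_flatC.
exact: double_quotient_chars_absurd m4 mE hA hB hC.
Qed.

Theorem theorem1p3 (R : realType) (m : nat) (hm : (m <= 4)%N)
    (T : tensor (complex R) m) (hT : minimal_border_rank T) :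
  one_star_generic T.
Proof. exact: minimal_border_rank_generic hm hT. Qed.
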